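(* Let $\mathcal{F}^\mathcal{P}$ be the family of product chains induced by $\mathcal{F}$ and $\mathcal{P}$, and assume all chains in $\mathcal{F}$ are reversible. Then $\mathcal{F}^\mathcal{P}$ has an $L^2$-cutoff if and only if $\tilde\tau_n(c)\rho_{n,\tilde j_n(c)}\to\infty$ for all $c>0$. Further, if $\mathcal{F}^\mathcal{P}$ has an $L^2$-cutoff, then $\tilde\tau_n(c)$ is an $L^2$-cutoff time for every $c>0$ and \[|T_{n,2}(\mu_n,\epsilon)-\tilde\tau_n(c)|=O\big(\sqrt{\tilde\tau_n(c)/\rho_{n,\tilde j_n(c)}}\big)\quad\forall\epsilon,c>0.\]
   Context: $\mathcal{F}=\{(\mu_{n,i},\mathcal{S}_{n,i},L_{n,i},\pi_{n,i}):1\le i\le\ell_n,n\ge1\}$ is a triangular array of irreducible continuous-time finite Markov chains and $\mathcal{P}=\{p_{n,i}>0\}$ with $\sum_ip_{n,i}\le1$. The product chain $(\mu_n,\mathcal{S}_n,L_n,\pi_n)$ has $\mathcal{S}_n=\prod_i\mathcal{S}_{n,i}$, $\mu_n=\prod_i\mu_{n,i}$, $\pi_n=\prod_i\pi_{n,i}$, $L_n=\sum_ip_{n,i}I_{n,1}\otimes\cdots\otimes L_{n,i}\otimes\cdots\otimes I_{n,\ell_n}$. Let $0=\lambda_{n,i,0},\lambda_{n,i,1},\dots,\lambda_{n,i,|\mathcal{S}_{n,i}|-1}$ be the eigenvalues of $-L_{n,i}$ with $L^2(\pi_{n,i})$-orthonormal right eigenvectors $\phi_{n,i,0}=\mathbf1,\phi_{n,i,1},\dots$.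 Enumerate the multiset $\{p_{n,i}\lambda_{n,i,j}:1\le j<|\mathcal{S}_{n,i}|,1\le i\le\ell_n\}$ as $\rho_{n,1}\le\rho_{n,2}\le\cdots$ and let $\psi_{n,l}$ be the corresponding value $\mu_{n,i}(\phi_{n,i,j})=\sum_x\mu_{n,i}(x)\phi_{n,i,j}(x)$. For $c>0$: $\tilde j_n(c)=\min\{j\ge1:\sum_{l=1}^j\psi_{n,l}^2>c\}$ and $\tilde\tau_n(c)=\max_{j\ge\tilde j_n(c)}\frac{\log(1+\sum_{l=1}^j|\psi_{n,l}|^2)}{2\rho_{n,j}}$. $d_{n,2}(\mu_n,t)=\|\mu_ne^{tL_n}/\pi_n-1\|_{L^2(\pi_n)}$, $T_{n,2}(\mu_n,\epsilon)=\min\{t\ge0:d_{n,2}(\mu_n,t)\le\epsilon\}$. $L^2$-cutoff: there is $t_n>0$ with $d_{n,2}(\mu_n,(1+a)t_n)\to0$ and $d_{n,2}(\mu_n,(1-a)t_n)\to\infty$ for all $a\in(0,1)$ ($t_n$ a cutoff time). $a_n=O(b_n)$ means $\sup_na_n/b_n<\infty$. *)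

(* Defs.v *)
From Stdlib Require Import Reals ClassicalEpsilon Relations.
From mathcomp Require Import all_boot.
Set Implicit Arguments. Unset Strict Implicit. Unset Printing Implicit Defensive.

Local Open Scope R_scope.

Definition rsum {T : finType} (F : T -> R) : R := \big[Rplus/0]_(x : T) F x.

Section Chain.
Variable St : finType.

Definition is_dist (m : St -> R) : Prop := (forall x, 0 <= m x) /\ rsum m = 1.

Definition is_generator (L : St -> St -> R) : Prop :=
  (forall x y, x <> y -> 0 <= L x y) /\ (forall x, rsum (fun y => L x y) = 0).

Definition irreducible (L : St -> St -> R) : Prop :=
  forall x y, clos_refl_trans St (fun a b => 0 < L a b) x y.

Definition stationary (L : St -> St -> R) (pi : St -> R) : Prop :=
  forall y, rsum (fun x => pi x * L x y) = 0.

Definition finite_chain (mu : St -> R) (L : St -> St -> R) (pi : St -> R) : Prop :=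
  is_dist mu /\ is_generator L /\ irreducible L /\ is_dist pi /\ stationary L pi.

Definition reversible (L : St -> St -> R) (pi : St -> R) : Prop :=
  forall x y, pi x * L x y = pi y * L y x.

Fixpoint mpow (L : St -> St -> R) (k : nat) : St -> St -> R :=
  match k with
  | O => fun x y => if x == y then 1 else 0
  | k'.+1 => fun x y => rsum (fun z => L x z * mpow L k' z y)
  end.

Definition hk (L : St -> St -> R) (t : R) (x y : St) : R :=
  epsilon (inhabits 0) (fun v =>
    Un_cv (fun M => sum_f_R0 (fun k => pow t k / INR (k`!) * mpow L k x y) M) v).

Definition evolve (mu : St -> R) (L : St -> St -> R) (t : R) : St -> R :=
  fun y => rsum (fun x => mu x * hk L t x y).

Definition l2dist (pi nu : St -> R) : R :=
  sqrt (rsum (fun y => pi y * (nu y / pi y - 1) ^ 2)).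

End Chain.

Definition eigen_data (m : nat) (L : 'I_m -> 'I_m -> R) (pi : 'I_m -> R)
  (lam : 'I_m -> R) (phi : 'I_m -> 'I_m -> R) : Prop :=
  (forall j : 'I_m, val j = 0%N -> lam j = 0 /\ forall x, phi j x = 1) /\
  (forall j x, rsum (fun y => L x y * phi j y) = - lam j * phi j x) /\
  (forall j k, rsum (fun x => pi x * phi j x * phi k x) = if j == k then 1 else 0).

Definition pstate (l : nat) (N : 'I_l -> nat) : finType :=
  {dffun forall i : 'I_l, 'I_(N i)}.

Definition prod_dist (l : nat) (N : 'I_l -> nat) (m : forall i, 'I_(N i) -> R)
  : pstate N -> R := fun x => \big[Rmult/1]_(i : 'I_l) m i (x i).

(* L = sum_i p_i I (x) ... (x) L_i (x) ... (x) I *)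
Definition prod_gen (l : nat) (N : 'I_l -> nat) (p : 'I_l -> R)
  (L : forall i, 'I_(N i) -> 'I_(N i) -> R) : pstate N -> pstate N -> R :=
  fun x y => rsum (fun i : 'I_l =>
    if [forall k : 'I_l, (k != i) ==> (x k == y k)] then p i * L i (x i) (y i) else 0).

Definition dprod (l : nat) (N : 'I_l -> nat) (mu pi : forall i, 'I_(N i) -> R)
  (p : 'I_l -> R) (L : forall i, 'I_(N i) -> 'I_(N i) -> R) (t : R) : R :=
  l2dist (prod_dist pi) (evolve (prod_dist mu) (prod_gen p L) t).

Definition Tmix (d : R -> R) (eps : R) : R :=
  epsilon (inhabits 0) (fun t =>
    0 <= t /\ d t <= eps /\ forall s, 0 <= s -> d s <= eps -> t <= s).

Definition idx (l : nat) (N : 'I_l -> nat) : Type := {i : 'I_l & 'I_(N i)}.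

(* number of nonzero eigenvalue slots: sum_i (|S_i| - 1) *)
Definition Kdim (l : nat) (N : 'I_l -> nat) : nat := (\sum_(i < l) (N i).-1)%N.

Definition rho_of (l : nat) (N : 'I_l -> nat) (p : 'I_l -> R)
  (lam : forall i, 'I_(N i) -> R) (e : nat -> idx N) (a : nat) : R :=
  p (tag (e a)) * lam (tag (e a)) (tagged (e a)).

Definition psi_of (l : nat) (N : 'I_l -> nat) (mu : forall i, 'I_(N i) -> R)
  (phi : forall i, 'I_(N i) -> 'I_(N i) -> R) (e : nat -> idx N) (a : nat) : R :=
  rsum (fun x => mu (tag (e a)) x * phi (tag (e a)) (tagged (e a)) x).

Definition sorted_enum (l : nat) (N : 'I_l -> nat) (p : 'I_l -> R)
  (lam : forall i, 'I_(N i) -> R) (e : nat -> idx N) : Prop :=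
  let K := Kdim N in
  (forall a b, (1 <= a <= K)%N -> (1 <= b <= K)%N -> e a = e b -> a = b) /\
  (forall a, (1 <= a <= K)%N -> val (tagged (e a)) <> 0%N) /\
  (forall ij : idx N, val (tagged ij) <> 0%N -> exists a, (1 <= a <= K)%N /\ e a = ij) /\
  (forall a b, (1 <= a)%N -> (a <= b <= K)%N -> rho_of p lam e a <= rho_of p lam e b).

Definition psum (psi : nat -> R) (j : nat) : R :=
  \big[Rplus/0]_(1 <= k < j.+1) (psi k) ^ 2.

(* tilde j(c) = min { 1 <= j <= K : psum j > c }; equals K+1 if no such j *)
Definition jtil (K : nat) (psi : nat -> R) (c : R) : nat :=
  (find (fun j => if Rlt_dec c (psum psi j) then true else false) (iota 1 K)).+1.

Definition tautil (K : nat) (rho psi : nat -> R) (c : R) : R :=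
  \big[Rmax/0]_(jtil K psi c <= j < K.+1) (ln (1 + psum psi j) / (2 * rho j)).

Definition cutoff_time (d : nat -> R -> R) (t : nat -> R) : Prop :=
  (exists n0, forall n, (n0 <= n)%N -> 0 < t n) /\
  forall a, 0 < a < 1 ->
    Un_cv (fun n => d n ((1 + a) * t n)) 0 /\ cv_infty (fun n => d n ((1 - a) * t n)).

Definition has_cutoff (d : nat -> R -> R) : Prop :=
  exists t : nat -> R, (forall n, 0 < t n) /\ cutoff_time d t.

(* Main.v *)
Require Import Defs.
From Stdlib Require Import Reals Lra Factorial ClassicalEpsilon Relations.
From Coquelicot Require Rcomplements Continuity.
From mathcomp Require Import all_boot ssralg matrix Rstruct.
Set Implicit Arguments. Unset Strict Implicit. Unset Printing Implicit Defensive.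
Delimit Scope R_scope with R.
Local Open Scope R_scope.

(** Let [A(t)] be the sum over [k] of [psi_k ^ 2 exp (- 2 rho_k t)]. Tensor products of the
eigenvectors diagonalize the product generator, so [1 + d(t) ^ 2] is the product over the
coordinates [i] of [1 + a_i(t)], where the [a_i(t)] sum up to [A(t)]; hence
[A <= d ^ 2 <= exp A - 1] and [d] may be replaced by [A].

Write [tau = tau(c)] and [r = rho_{j(c)}]. The term attaining the maximum in [tau] yields
[A(t) >= c / (1 + c) exp (2 r (tau - t))] for [t <= tau]. Conversely, for [k >= j(c)] the
definition of [tau] says [exp (- 2 rho_k tau) <= 1 / (1 + W_k)] with [W_k] the partial sums of
[psi_k ^ 2]; comparing with an integral and cutting the sum at [j(c') <= j(c)],
[A(tau + u) <= c' + c exp (- 2 rho_{j(c')} tau) + (2 tau / u) exp (- r u)] for [u > 0].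
Everything follows from these two bounds, the window from [u = M sqrt (tau / r)]. *)

(** * Finite sums of real numbers *)

Lemma rsum_ge0 (T : finType) (P : pred T) (F : T -> R) :
  (forall x, P x -> 0 <= F x) -> 0 <= \big[Rplus/0]_(x | P x) F x.
Proof. by move=> F0; elim/big_ind: _ => //; [lra | move=> *; lra]. Qed.

Lemma eq_rsum (T : finType) (F G : T -> R) : (forall x, F x = G x) -> rsum F = rsum G.
Proof. by move=> FG; apply: eq_bigr => x _. Qed.

Lemma rsum_scal (T : finType) (a : R) (F : T -> R) : rsum (fun x => a * F x) = a * rsum F.
Proof. by rewrite /rsum big_distrr. Qed.

Lemma rsum_scalr (T : finType) (a : R) (F : T -> R) : rsum (fun x => F x * a) = rsum F * a.
Proof. by rewrite /rsum big_distrl. Qed.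

Lemma rsumD (T : finType) (F G : T -> R) : rsum (fun x => F x + G x) = rsum F + rsum G.
Proof. by rewrite /rsum big_split. Qed.

Lemma rsum_exch (T U : finType) (F : T -> U -> R) :
  rsum (fun x => rsum (F x)) = rsum (fun y => rsum (fun x => F x y)).
Proof. by rewrite /rsum exchange_big. Qed.

Lemma rsum_delta (T : finType) (x : T) (F : T -> R) :
  rsum (fun y => (if y == x then 1 else 0) * F y) = F x.
Proof.
rewrite /rsum (bigD1 x) //= eqxx big1; first by lra.
by move=> y /negbTE ->; lra.
Qed.

Lemma rsum_eq0 (T : finType) (F : T -> R) :
  (forall x, 0 <= F x) -> rsum F = 0 -> forall x, F x = 0.
Proof.
move=> F0; rewrite /rsum => + x; rewrite (bigD1 x) //= => s0.
have := F0 x; have := @rsum_ge0 T (fun i => i != x) F (fun i _ => F0 i); lra.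
Qed.

(** Distributivity when the range of summation varies with the factor. [big_fprod] speaks of
    [fprod], so the identity is transported along the bijection with [dffun]. This is what makes
    sums over product states factorize. *)
Lemma prod_rsum (l : nat) (N : 'I_l -> nat) (F : forall i, 'I_(N i) -> R) :
  \big[Rmult/1]_(i : 'I_l) rsum (F i) =
  rsum (fun x : pstate N => \big[Rmult/1]_(i : 'I_l) F i (x i)).
Proof.
under eq_bigr do rewrite /rsum (big_tag (T_ := fun i : 'I_l => 'I_(N i))).
rewrite bigA_distr_big_dep /=.
have E := big_fprod 1 Rplus (fun i => [ffun u => F i u]).
transitivity (\big[Rplus/0]_(t : fprod (fun i : 'I_l => 'I_(N i)))
   \big[Rmult/1]_i F i (t i)).
  transitivity (\big[Rplus/0]_(t : fprod (fun i : 'I_l => 'I_(N i)))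
     \big[Rmult/1]_(i in 'I_l) [ffun u => F i u] (t i)).
    rewrite E; apply: eq_bigr => g _; apply: eq_bigr => i _.
    rewrite /untag; case: eqP => // ?; by rewrite ffunE.
  by apply: eq_bigr => t _; apply: eq_bigr => i _; rewrite ffunE.
rewrite (reindex (@fprod_of_dffun _ (fun i : 'I_l => 'I_(N i)))) /=; last first.
  exact/onW_bij/fprod_of_dffun_bij.
apply: eq_bigr => x _; apply: eq_bigr => i _.
congr (F i _). by rewrite -[in RHS](fprod_of_dffunK x) ffunE.
Qed.

Section Complete.
Local Open Scope ring_scope.
Import GRing.Theory.

(* The matrix of the [phi j x] is square, so its right inverse is also a left inverse. *)
Lemma eigen_complete m (L : 'I_m -> 'I_m -> R) pi lam phi :
  eigen_data L pi lam phi ->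
  forall x y, rsum (fun j => phi j x * phi j y * pi y) = if x == y then 1 else 0.
Proof.
move=> [_ [_ orth]] x y.
pose A : 'M[R]_m := \matrix_(j, x) phi j x.
pose B : 'M[R]_m := \matrix_(x, j) (pi x * phi j x).
have AB : A *m B = 1%:M.
  apply/matrixP => j k; rewrite !mxE.
  transitivity (if j == k then 1 else 0 : R); last by case: eqP.
  rewrite -(orth j k) /rsum; apply: eq_bigr => z _; rewrite !mxE.
  by rewrite mulrCA mulrA.
have /matrixP /(_ y x) := mulmx1C AB; rewrite !mxE eq_sym => E.
transitivity ((x == y)%:R : R); last by case: eqP.
rewrite -E /rsum; apply: eq_bigr => j _; rewrite !mxE.
by rewrite -[LHS]mulrC -mulrA [X in _ * X]mulrC.
Qed.

End Complete.

Lemma exp_le x y : x <= y -> exp x <= exp y.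
Proof. by case=> [/exp_increasing|->]; lra. Qed.

(** * Spectral formula for the chi-square distance *)

Lemma fact_factorial k : fact k = k`!.
Proof. by elim: k => //= k ->; rewrite factS mulSn. Qed.

Lemma Un_cv_rsum (T : finType) (u : nat -> T -> R) (v : T -> R) :
  (forall x, Un_cv (fun n => u n x) (v x)) -> Un_cv (fun n => rsum (u n)) (rsum v).
Proof.
move=> uv; rewrite /rsum; elim: (index_enum T) => [|a s IH].
  rewrite big_nil; apply: (Un_cv_ext (fun=> 0)); first by move=> n; rewrite big_nil.
  by move=> e e0; exists O => n _; rewrite /Rdist Rminus_diag Rabs_R0.
rewrite big_cons; apply: (Un_cv_ext (fun n => u n a + \big[Rplus/0]_(i <- s) u n i)).
  by move=> n; rewrite big_cons.
exact: CV_plus.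
Qed.

Lemma sum_f_R0_rsum (T : finType) (F : nat -> T -> R) M :
  sum_f_R0 (fun k => rsum (F k)) M = rsum (fun x => sum_f_R0 (fun k => F k x) M).
Proof. by elim: M => //= M ->; rewrite -rsumD. Qed.

Lemma rsumD1 (T : finType) (x : T) (F : T -> R) :
  rsum F = F x + \big[Rplus/0]_(y | y != x) F y.
Proof. by rewrite /rsum (bigD1 x). Qed.

Section Spectral.
Variables (S I : finType) (L : S -> S -> R) (pi : S -> R) (Psi : I -> S -> R) (Lam : I -> R).
Hypothesis eig : forall J x, rsum (fun y => L x y * Psi J y) = - Lam J * Psi J x.
Hypothesis compl : forall x y,
  rsum (fun J => Psi J x * Psi J y * pi y) = if x == y then 1 else 0.

(** Completeness is the case [k = 0]; each further factor [L] acts on [Psi J] as multiplication by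
    [- Lam J]. *)
Lemma mpow_spectral k x y :
  mpow L k x y = rsum (fun J => (- Lam J) ^ k * (Psi J x * Psi J y * pi y)).
Proof.
elim: k x => [|k IH] x /=.
  by rewrite -compl; apply: eq_rsum => J; ring.
under eq_rsum do rewrite IH -rsum_scal.
rewrite rsum_exch; apply: eq_rsum => J.
transitivity ((- Lam J) ^ k * (Psi J y * pi y) * rsum (fun z => L x z * Psi J z)).
  by rewrite -rsum_scal; apply: eq_rsum => z; ring.
by rewrite eig; ring.
Qed.

(** [hk] is chosen by [epsilon] as a limit of partial sums. The spectral sum is such a limit, and
    limits are unique. *)
Lemma hk_spectral t x y :
  hk L t x y = rsum (fun J => exp (- (t * Lam J)) * (Psi J x * Psi J y * pi y)).
Proof.
set v := rsum _.
have cv : Un_cv (fun M => sum_f_R0 (fun k => pow t k / INR (k`!) * mpow L k x y) M) v.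
  apply: (Un_cv_ext (fun M => rsum (fun J =>
     sum_f_R0 (fun k => / INR (fact k) * (- (t * Lam J)) ^ k) M
       * (Psi J x * Psi J y * pi y)))).
    move=> M; rewrite /= -[RHS]/(sum_f_R0 _ M).
    transitivity (sum_f_R0 (fun k => rsum (fun J => / INR (fact k) * (- (t * Lam J)) ^ k
       * (Psi J x * Psi J y * pi y))) M).
      rewrite sum_f_R0_rsum; apply: eq_rsum => J.
      by rewrite Rmult_comm scal_sum.
    apply: PartSum.sum_eq => k _; rewrite mpow_spectral -rsum_scal fact_factorial.
    apply: eq_rsum => J; rewrite Ropp_mult_distr_r Rpow_mult_distr /Rdiv; ring.
  apply: Un_cv_rsum => J; apply: CV_mult.
    by rewrite /exp; case: exist_exp.
  by move=> e e0; exists O => n _; rewrite /Rdist Rminus_diag Rabs_R0.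
rewrite /hk.
have := epsilon_spec (inhabits 0) _ (ex_intro _ v cv).
by move/UL_sequence => /(_ _ cv).
Qed.

Hypothesis orth : forall J K,
  rsum (fun x => pi x * Psi J x * Psi K x) = if J == K then 1 else 0.
Hypothesis pi_gt0 : forall x, 0 < pi x.
Variables (J0 : I) (mu : S -> R).
Hypothesis Psi0 : forall x, Psi J0 x = 1.
Hypothesis Lam0 : Lam J0 = 0.
Hypothesis mu1 : rsum mu = 1.

Lemma parseval (a : I -> R) :
  rsum (fun y => pi y * rsum (fun J => a J * Psi J y) ^ 2) = rsum (fun J => a J ^ 2).
Proof.
transitivity (rsum (fun J => rsum (fun K => (if K == J then 1 else 0) * (a J * a K)))).
  transitivity (rsum (fun J => rsum (fun K => rsum (fun y =>
     pi y * Psi K y * Psi J y * (a J * a K))))); last first.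
    by apply: eq_rsum => J; apply: eq_rsum => K; rewrite rsum_scalr orth.
  under [RHS]eq_rsum do rewrite rsum_exch; rewrite [RHS]rsum_exch.
  apply: eq_rsum => y.
  rewrite /= Rmult_1_r -rsum_scalr -rsum_scal; apply: eq_rsum => J.
  rewrite -[in LHS]rsum_scal -rsum_scal; apply: eq_rsum => K; ring.
by apply: eq_rsum => J; rewrite rsum_delta; ring.
Qed.

Lemma l2dist_spectral t :
  l2dist pi (evolve mu L t) ^ 2 =
  rsum (fun J => rsum (fun x => mu x * Psi J x) ^ 2 * exp (- (2 * t * Lam J))) - 1.
Proof.
pose b J := rsum (fun x => mu x * Psi J x) * exp (- (t * Lam J)).
have b0 : b J0 = 1.
  rewrite /b Lam0 Rmult_0_r Ropp_0 exp_0 Rmult_1_r -mu1.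
  by apply: eq_rsum => x; rewrite Psi0 Rmult_1_r.
(* The constant mode [J0] has coefficient 1, so subtracting 1 from the density removes exactly this
   mode. *)
pose a J := if J == J0 then 0 else b J.
have E y : evolve mu L t y / pi y - 1 = rsum (fun J => a J * Psi J y).
  have -> : evolve mu L t y = pi y * rsum (fun J => b J * Psi J y).
    rewrite /evolve; under eq_rsum do rewrite hk_spectral -rsum_scal.
    rewrite rsum_exch -rsum_scal; apply: eq_rsum => J.
    rewrite /b.
    transitivity (rsum (fun x => mu x * Psi J x) * (exp (- (t * Lam J)) * (Psi J y * pi y))).
      by rewrite -rsum_scalr; apply: eq_rsum => x; ring.
    ring.
  rewrite (rsumD1 J0) [in RHS](rsumD1 J0) /a eqxx b0 Psi0.
  under [in RHS]eq_bigr => J /negbTE JJ do rewrite JJ.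
  by field; have := pi_gt0 y; lra.
rewrite /l2dist pow2_sqrt; last first.
  apply: rsum_ge0 => y _; apply: Rmult_le_pos; [exact/Rlt_le | exact: pow2_ge_0].
under eq_rsum do rewrite E.
rewrite parseval.
transitivity (rsum (fun J => b J ^ 2) - 1).
  rewrite (rsumD1 J0) [in RHS](rsumD1 J0) /a eqxx b0.
  under eq_bigr => J /negbTE JJ do rewrite JJ.
  ring.
congr (_ - 1); apply: eq_rsum => J; rewrite /b Rpow_mult_distr; congr (_ * _).
rewrite /= Rmult_1_r -exp_plus; congr exp; ring.
Qed.

End Spectral.

(** * Reversible chains and their products *)

(** By detailed balance, a zero of [pi] at [b] forces a zero at each [a] with [L a b > 0].
    Irreducibility would spread it everywhere, against total mass 1. *)
Lemma stationary_gt0 (S : finType) (L : S -> S -> R) (pi : S -> R) :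
  irreducible L -> is_dist pi -> reversible L pi ->
  forall x, 0 < pi x.
Proof.
move=> irr [pi0 pi1] rev x.
case: (Rle_lt_or_eq_dec _ _ (pi0 x)) => // /esym pix; exfalso.
suff z y : pi y = 0.
  by move: pi1; rewrite /rsum big1 => [|y _]; [lra | exact: z].
elim: (irr y x) pix => // {x y} [a b Lab pib | x y z _ IH1 _ IH2 /IH2/IH1 //].
by have := rev a b; rewrite pib; have := pi0 a; nra.
Qed.

Section Reversible.
Variables (m : nat) (L : 'I_m -> 'I_m -> R) (pi lam : 'I_m -> R) (phi : 'I_m -> 'I_m -> R).
Hypotheses (gL : is_generator L) (irr : irreducible L) (rev : reversible L pi).
Hypotheses (pi0 : forall x, 0 < pi x) (ed : eigen_data L pi lam phi).

(** Expand the square. The two pure squares vanish, since rows of [L] sum to 0 and, by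
    reversibility, so do the columns weighted by [pi]; the cross term is evaluated by the eigenvalue
    equation. *)
Lemma dirichlet_form (j : 'I_m) :
  rsum (fun x => rsum (fun y => pi x * L x y * (phi j x - phi j y) ^ 2)) = 2 * lam j.
Proof.
have [_ [eig orth]] := ed.
have rowsum x : rsum (fun y => L x y) = 0 by case: gL => _ ->.
have colsum y : rsum (fun x => pi x * L x y) = 0.
  under eq_rsum do rewrite rev; by rewrite rsum_scal rowsum Rmult_0_r.
transitivity (rsum (fun x => rsum (fun y => pi x * phi j x ^ 2 * L x y))
   + rsum (fun x => rsum (fun y => phi j y ^ 2 * (pi x * L x y)))
   + rsum (fun x => rsum (fun y => -2 * pi x * phi j x * (L x y * phi j y)))).
  rewrite -!rsumD; apply: eq_rsum => x; rewrite -!rsumD; apply: eq_rsum => y; ring.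
rewrite (_ : rsum (fun x => rsum (fun y => pi x * phi j x ^ 2 * L x y)) = 0); last first.
  by rewrite /rsum big1 // => x _; rewrite -/(rsum _) rsum_scal rowsum Rmult_0_r.
rewrite [X in 0 + X + _]rsum_exch.
rewrite (_ : rsum (fun y => rsum (fun x => phi j y ^ 2 * (pi x * L x y))) = 0); last first.
  by rewrite /rsum big1 // => y _; rewrite -/(rsum _) rsum_scal colsum Rmult_0_r.
transitivity (2 * lam j * rsum (fun x => pi x * phi j x * phi j x)).
  rewrite -rsum_scal !Rplus_0_l; apply: eq_rsum => x; rewrite rsum_scal eig; ring.
by rewrite orth eqxx Rmult_1_r.
Qed.

(** A zero eigenvalue makes the Dirichlet form vanish, so [phi j] is constant along edges, hence
    constant by irreducibility. This contradicts norm 1 together with orthogonality to the constant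
    eigenvector of index 0. *)
Lemma eigenvalue_gt0 (j : 'I_m) : val j <> 0%N -> 0 < lam j.
Proof.
move=> j0; have [triv [eig orth]] := ed.
have term0 x y : 0 <= pi x * L x y * (phi j x - phi j y) ^ 2.
  (* Diagonal entries of [L] may be negative, but there the difference is 0. *)
  have [->|/eqP xy] := eqVneq x y; first by rewrite Rminus_diag /= Rmult_0_l Rmult_0_r; lra.
  apply: Rmult_le_pos; last exact: pow2_ge_0.
  by apply: Rmult_le_pos; [exact/Rlt_le | case: gL => + _; exact].
have row0 x : 0 <= rsum (fun y => pi x * L x y * (phi j x - phi j y) ^ 2).
  by apply: rsum_ge0.
have : 0 <= lam j.
  have : 0 <= 2 * lam j; last by lra.
  by rewrite -dirichlet_form; apply: rsum_ge0.
move=> /Rle_lt_or_eq_dec[]// lam0; exfalso.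
have const x y : phi j x = phi j y.
  elim: (irr x y) => // {x y} [x y Lxy | x y z _ -> _ -> //].
  have := dirichlet_form j; rewrite -lam0 Rmult_0_r => /(rsum_eq0 row0)/(_ x).
  move=> /(rsum_eq0 (term0 x))/(_ y) E.
  have := pi0 x; have : phi j x - phi j y = 0; last by lra.
  case/Rmult_integral: E => [/Rmult_integral[]|]; [have := pi0 x; lra | lra |].
  by case/Rmult_integral => //; rewrite Rmult_1_r.
have m0 : (0 < m)%N by case: (m) j {j0 lam0 const row0 term0} => [[]//|].
pose j0' := Ordinal m0.
have := orth j j0'; case: eqP => [E|_]; first by case: j0; rewrite E.
have := orth j j; rewrite eqxx.
rewrite (_ : rsum _ = phi j j * rsum (fun x => pi x * phi j x)); last first.
  by rewrite -rsum_scal; apply: eq_rsum => x; rewrite (const x j); ring.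
move=> + E; rewrite (_ : rsum (fun x => pi x * phi j x) = 0); first by lra.
by rewrite -E; apply: eq_rsum => x; rewrite (triv j0' erefl).2 Rmult_1_r.
Qed.

End Reversible.

Section Product.
Unset Implicit Arguments.
Variables (l : nat) (N : 'I_l -> nat) (p : 'I_l -> R).
Variables (L : forall i, 'I_(N i) -> 'I_(N i) -> R) (mu pi lam : forall i, 'I_(N i) -> R).
Variable phi : forall i, 'I_(N i) -> 'I_(N i) -> R.
Set Implicit Arguments.
Hypothesis ed : forall i, eigen_data (L i) (pi i) (lam i) (phi i).

Definition prod_phi (J x : pstate N) : R := \big[Rmult/1]_(i : 'I_l) phi i (J i) (x i).
Definition prod_lam (J : pstate N) : R := rsum (fun i => p i * lam i (J i)).

Lemma prod_delta (T : finType) (P : pred T) :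
  \big[Rmult/1]_(i : T) (if P i then 1 else 0) = if [forall i, P i] then 1 else 0.
Proof.
case: forallP => [H|/forallP]; first by rewrite big1 // => i _; rewrite H.
rewrite negb_forall => /existsP[i /negbTE Pi].
by rewrite (bigD1 i) //= Pi Rmult_0_l.
Qed.

Lemma forall_eq_pstate (x y : pstate N) : [forall i, x i == y i] = (x == y).
Proof. by apply/forallP/eqP => [H|-> i //]; apply/ffunP => i; exact/eqP. Qed.

Lemma prod_gen_eig J x :
  rsum (fun y => prod_gen p L x y * prod_phi J y) = - prod_lam J * prod_phi J x.
Proof.
(* The [i]-th summand of the generator becomes a full product over coordinates, with [L i] at [i]
   and Kronecker deltas elsewhere, so that the sum over [y] factorizes. *)
transitivity (rsum (fun i => p i * rsum (fun y : pstate N => \big[Rmult/1]_(k : 'I_l)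
   ((if k == i then L k (x k) (y k) else if y k == x k then 1 else 0)
     * phi k (J k) (y k))))).
  under [RHS]eq_rsum do rewrite -rsum_scal.
  rewrite rsum_exch; apply: eq_rsum => y; rewrite /prod_gen -rsum_scalr.
  apply: eq_rsum => i; rewrite big_split /= -Rmult_assoc; congr (_ * _).
  rewrite (bigD1 i) //= eqxx.
  rewrite (_ : \big[Rmult/1]_(k < l | k != i) _ =
    if [forall k : 'I_l, (k != i) ==> (x k == y k)] then 1 else 0).
    by case: ifP => _; ring.
  rewrite -prod_delta [RHS](bigD1 i) //= eqxx Rmult_1_l; apply: eq_bigr => k ki.
  by rewrite (negbTE ki) eq_sym.
rewrite /prod_lam Ropp_mult_distr_l_reverse -rsum_scalr.
rewrite -[RHS]Rmult_1_l -Ropp_mult_distr_r Ropp_mult_distr_l -rsum_scal.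
apply: eq_rsum => i.
rewrite -(prod_rsum (fun k z => (if k == i then L k (x k) z
   else if z == x k then 1 else 0) * phi k (J k) z)).
rewrite (bigD1 i) //= eqxx /prod_phi [in RHS](bigD1 i) //=.
have [_ [-> _]] := ed i.
rewrite (eq_bigr (fun k => phi k (J k) (x k))).
  by move: (\big[_/_]_(_ | _) _) (lam i (J i)) (phi i _ _) => B c q; ring.
by move=> k /negbTE ->; rewrite rsum_delta.
Qed.

Lemma prod_complete x y :
  rsum (fun J => prod_phi J x * prod_phi J y * prod_dist pi y) = if x == y then 1 else 0.
Proof.
rewrite -forall_eq_pstate -prod_delta.
under [RHS]eq_bigr => i _ do rewrite -(eigen_complete (ed i)).
by rewrite prod_rsum; apply: eq_rsum => J; rewrite !big_split.
Qed.

Lemma prod_orth J K :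
  rsum (fun x => prod_dist pi x * prod_phi J x * prod_phi K x) = if J == K then 1 else 0.
Proof.
rewrite -forall_eq_pstate -prod_delta.
transitivity (\big[Rmult/1]_(i < l) rsum (fun x => pi i x * phi i (J i) x * phi i (K i) x)).
  by rewrite prod_rsum; apply: eq_rsum => x; rewrite !big_split.
by apply: eq_bigr => i _; have [_ [_ ->]] := ed i.
Qed.

Lemma prod_gt0 (T : finType) (F : T -> R) : (forall i, 0 < F i) -> 0 < \big[Rmult/1]_(i : T) F i.
Proof. by move=> F0; elim/big_ind: _ => //; [lra | exact: Rmult_lt_0_compat]. Qed.

Lemma exp_rsum (T : finType) (F : T -> R) : exp (rsum F) = \big[Rmult/1]_(i : T) exp (F i).
Proof. exact: (big_morph exp exp_plus exp_0). Qed.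

Lemma dprod_product t :
  (forall i, is_dist (mu i)) -> (forall i x, 0 < pi i x) ->
  dprod mu pi p L t ^ 2 =
  \big[Rmult/1]_(i < l) rsum (fun j =>
     rsum (fun x => mu i x * phi i j x) ^ 2 * exp (- (2 * t * (p i * lam i j)))) - 1.
Proof.
move=> dmu pi0.
have N0 i : (0 < N i)%N.
  case: (dmu i) => _; rewrite /rsum; case: (N i) (mu i) => // mui.
  by rewrite big_ord0; lra.
(* The multi-index 0 labels the constant eigenvector; the factors are nonempty because [mu i] has
   mass 1. *)
pose J0 : pstate N := [ffun i => Ordinal (N0 i)].
have sqrM : {morph (fun x : R => x ^ 2) : x y / x * y >-> x * y}.
  by move=> x y; rewrite Rpow_mult_distr.
have sqr1 : 1 ^ 2 = 1 by ring.
rewrite /dprod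
  (@l2dist_spectral _ _ _ _ prod_phi prod_lam prod_gen_eig prod_complete prod_orth _ J0).
- congr (_ - 1); rewrite prod_rsum; apply: eq_rsum => J.
  rewrite big_split /= -exp_rsum; congr (_ * exp _).
    rewrite -(big_morph _ sqrM sqr1); congr (_ ^ 2).
    by rewrite prod_rsum; apply: eq_rsum => x; rewrite big_split.
  transitivity (- (2 * t) * prod_lam J); first by ring.
  by rewrite /prod_lam -rsum_scal; apply: eq_rsum => i; move: (lam i (J i)) => c; ring.
- move=> x; exact: prod_gt0.
- move=> x; rewrite /prod_phi big1 // => i _; case: (ed i) => /(_ (J0 i)) + _.
  by rewrite ffunE => /(_ erefl)[].
- rewrite /prod_lam /rsum big1 // => i _; case: (ed i) => /(_ (J0 i)) + _.
  by rewrite ffunE => /(_ erefl)[-> _]; rewrite Rmult_0_r.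
- rewrite -prod_rsum big1 // => i _; exact: (dmu i).2.
Qed.

End Product.

(** * The distance against the Laplace transform *)

(** This is [A(t)]: the Laplace transform at [2 t] of the measure with mass [psi k ^ 2] at [rho k].
    It retains only the eigenvectors of the product that depend on a single coordinate. *)
Definition laplace (K : nat) (rho psi : nat -> R) (t : R) : R :=
  \big[Rplus/0]_(1 <= k < K.+1) (psi k ^ 2 * exp (- (2 * rho k * t))).

(** The lower bound keeps the linear part of the expanded product; the upper one is [1 + x <= exp x]
    in each factor. *)
Lemma prod_1p_bounds (T : finType) (a : T -> R) :
  (forall i, 0 <= a i) ->
  1 + rsum a <= \big[Rmult/1]_(i : T) (1 + a i) <= exp (rsum a).
Proof.
move=> a0; rewrite /rsum; elim: (index_enum T) => [|i s IH].
  rewrite !big_nil exp_0; lra.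
rewrite !big_cons exp_plus.
have := exp_ineq1_le (a i); have := a0 i.
have : 0 <= \big[Rplus/0]_(j <- s) a j by elim/big_ind: _ => //; [lra | move=> *; lra].
nra.
Qed.

Lemma continuity_rsum (T : finType) (f : T -> R -> R) :
  (forall i, continuity (f i)) -> continuity (fun t => rsum (fun i => f i t)).
Proof.
move=> cf t; rewrite /rsum; elim: (index_enum T) => [|i s IH].
  apply: (Continuity.continuity_pt_ext (fun=> 0)); first by move=> x; rewrite big_nil.
  exact: continuity_pt_const.
apply: (Continuity.continuity_pt_ext (f i + fun x => \big[Rplus/0]_(i <- s) f i x)%F).
  by move=> x; rewrite big_cons.
by apply: continuity_pt_plus => //; apply: cf.
Qed.

Lemma continuity_prod (T : finType) (f : T -> R -> R) :
  (forall i, continuity (f i)) -> continuity (fun t => \big[Rmult/1]_(i : T) f i t).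
Proof.
move=> cf t; elim: (index_enum T) => [|i s IH].
  apply: (Continuity.continuity_pt_ext (fun=> 1)); first by move=> x; rewrite big_nil.
  exact: continuity_pt_const.
apply: (Continuity.continuity_pt_ext (f i * fun x => \big[Rmult/1]_(i <- s) f i x)%F).
  by move=> x; rewrite big_cons.
by apply: continuity_pt_mult => //; apply: cf.
Qed.

(** The minimum behind [epsilon] exists: the sublevel set is nonempty because of [t], bounded below
    by 0, and closed. Continuity is asked of the square, for which a product formula is
    available. *)
Lemma Tmix_spec (d : R -> R) (eps t : R) :
  continuity (fun s => d s ^ 2) -> (forall s, 0 <= d s) -> 0 <= t -> d t <= eps ->
  0 <= Tmix d eps /\ d (Tmix d eps) <= eps /\
  forall s, 0 <= s -> d s <= eps -> Tmix d eps <= s.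
Proof.
move=> cd d0 t0 dt; rewrite /Tmix; set P := fun _ => _.
suff : exists t, P t by move/(epsilon_spec (inhabits 0)).
(* Reflected set: [completeness] yields suprema, and an infimum is wanted. *)
pose E x := 0 <= - x /\ d (- x) <= eps.
have bE : bound E by exists 0 => x [x0 _]; lra.
have nE : exists x, E x by exists (- t); rewrite /E Ropp_involutive.
have [m [ub lub]] := completeness E bE nE.
have m0 : m <= 0 by apply: lub => x [x0 _]; lra.
have lb s : 0 <= s -> d s <= eps -> - m <= s.
  by move=> s0 ds; have := ub (- s); rewrite /E Ropp_involutive => /(_ (conj s0 ds)); lra.
exists (- m); split; [lra | split=> //].
apply: Rnot_lt_le => lt.
have gt0 : 0 < d (- m) ^ 2 - eps ^ 2.
  by have := d0 t; nra.
(* If [d (- m) > eps], then [d] stays above [eps] within distance [del], and [m - del] would be a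
   smaller upper bound of [E]. *)
have [del [del0 Hdel]] := cd (- m) _ gt0.
have : m <= m - del; last by lra.
apply: lub => x [x0 dx]; apply: Rnot_lt_le => xm.
have xm' := ub x (conj x0 dx).
have [E0|xm0] := Req_dec x m; first by move: dx; rewrite E0; lra.
have := Hdel (- x).
have h : D_x no_cond (- m) (- x) /\ R_dist (- x) (- m) < del.
  split; first by split=> //; lra.
  by rewrite /R_dist /Rdist Rabs_pos_eq; lra.
move=> /(_ h) /=; rewrite /R_dist /Rdist.
have := d0 (- x) => dx0.
have : d (- x) ^ 2 <= eps ^ 2 by nra.
move=> le; rewrite Rabs_minus_sym Rabs_pos_eq /=; simpl in *; lra.
Qed.

Section ProductDistance.
Variable l : nat.
Unset Implicit Arguments.
Variables (N : 'I_l -> nat) (p : 'I_l -> R).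
Variables (L : forall i, 'I_(N i) -> 'I_(N i) -> R) (mu pi lam : forall i, 'I_(N i) -> R).
Variable phi : forall i, 'I_(N i) -> 'I_(N i) -> R.
Set Implicit Arguments.
Variable e : nat -> idx N.
Hypothesis fc : forall i, finite_chain (mu i) (L i) (pi i).
Hypothesis rev : forall i, reversible (L i) (pi i).
Hypothesis p0 : forall i, 0 < p i.
Hypothesis ed : forall i, eigen_data (L i) (pi i) (lam i) (phi i).
Hypothesis se : sorted_enum p lam e.

Local Notation d := (dprod mu pi p L).
Local Notation K := (Kdim N).
Local Notation rho := (rho_of p lam e).
Local Notation psi := (psi_of mu phi e).

Lemma marginal_gt0 i x : 0 < pi i x.
Proof.
have [_ [gL [irr [dpi _]]]] := fc i.
exact: stationary_gt0 irr dpi (@rev i) x.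
Qed.

Lemma start_dist i : is_dist (mu i). Proof. by case: (fc i). Qed.

Lemma rho_of_gt0 k : (1 <= k <= K)%N -> 0 < rho k.
Proof.
move=> kK; have [_ [nz _]] := se; rewrite /rho_of.
have [_ [gL [irr _]]] := fc (tag (e k)).
apply: Rmult_lt_0_compat => //.
apply: (eigenvalue_gt0 gL irr (@rev _) (@marginal_gt0 _) (ed _)); exact: nz.
Qed.

Local Definition slot_term t (u : idx N) :=
  rsum (fun x => mu (tag u) x * phi (tag u) (tagged u) x) ^ 2 *
  exp (- (2 * t * (p (tag u) * lam (tag u) (tagged u)))).

(** [e] lists every pair with nonzero second component exactly once, so the sum over ranks can be
    regrouped by coordinate. *)
Lemma laplace_enum t :
  laplace K rho psi t = rsum (fun i => \big[Rplus/0]_(j | val j != 0%N)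
    slot_term t (existT (fun i => 'I_(N i) : Type) i j)).
Proof.
have [inj [nz [sur _]]] := se.
rewrite /rsum (sig_big_dep _ (fun (i : 'I_l) (j : 'I_(N i)) => val j != 0%N)
  (fun i j => slot_term t (existT (fun i => 'I_(N i) : Type) i j))) /=.
rewrite -[in RHS]big_filter.
transitivity (\big[Rplus/0]_(u <- [seq e k | k <- index_iota 1 K.+1]) slot_term t u).
  rewrite big_map; apply: eq_bigr => k _; congr (_ * exp _).
  by rewrite /rho_of; ring.
transitivity (\big[Rplus/0]_(u <- [seq u : {i : 'I_l & 'I_(N i)} <- index_enum _
     | val (tagged u) != 0%N]) slot_term t u); last by apply: eq_bigr => -[].
apply: perm_big; apply: uniq_perm.
- rewrite map_inj_in_uniq ?iota_uniq // => a b.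
  by rewrite !mem_index_iota => aK bK; apply: inj.
- exact/filter_uniq/index_enum_uniq.
- move=> u; rewrite mem_filter mem_index_enum andbT; apply/mapP/idP.
    by move=> [k]; rewrite mem_index_iota => kK ->; apply/eqP/nz.
  by move=> /eqP/sur[k [kK <-]]; exists k => //; rewrite mem_index_iota.
Qed.

(** In each coordinate factor the index 0 contributes exactly 1, leaving a product of [1 + a i] to
    which [prod_1p_bounds] applies. *)
Lemma dist_laplace t :
  laplace K rho psi t <= d t ^ 2 <= exp (laplace K rho psi t) - 1.
Proof.
rewrite (dprod_product p ed _ start_dist marginal_gt0) laplace_enum.
set a : 'I_l -> R := fun i => _.
have a0 i : 0 <= a i.
  apply: rsum_ge0 => j _; apply: Rmult_le_pos; [exact: pow2_ge_0 | exact/Rlt_le/exp_pos].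
suff E i : rsum (fun j => rsum (fun x => mu i x * phi i j x) ^ 2
    * exp (- (2 * t * (p i * lam i j)))) = 1 + a i.
  under eq_bigr do rewrite E; have := prod_1p_bounds a0; lra.
have [_ mu1] := start_dist i.
have N0 : (0 < N i)%N.
  move: mu1; rewrite /rsum; case: (N i) (mu i) => // mui.
  by rewrite big_ord0; lra.
rewrite (rsumD1 (Ordinal N0)) /a; congr (_ + _).
have [/(_ (Ordinal N0) erefl)[-> phi1] _] := ed i.
rewrite !Rmult_0_r Ropp_0 exp_0 (_ : rsum _ = 1); first by ring.
by rewrite -mu1; apply: eq_rsum => x; rewrite phi1 Rmult_1_r.
Qed.

Lemma dist_continuity : continuity (fun t => d t ^ 2).
Proof.
pose g t := \big[Rmult/1]_(i < l) rsum (fun j =>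
  rsum (fun x => mu i x * phi i j x) ^ 2 * exp (- (2 * t * (p i * lam i j)))) - 1.
move=> t; apply: (Continuity.continuity_pt_ext g) => [s|].
  by rewrite (dprod_product p ed s start_dist marginal_gt0).
apply: continuity_pt_minus; last exact: continuity_pt_const.
by apply: continuity_prod => i; apply: continuity_rsum => j; reg.
Qed.

End ProductDistance.

(** * Two-sided bounds on the Laplace transform *)

Section Laplace.
Variables (K : nat) (rho psi : nat -> R).
Hypothesis rho_gt0 : forall k, (1 <= k <= K)%N -> 0 < rho k.
Hypothesis rho_mono : forall a b, (1 <= a)%N -> (a <= b <= K)%N -> rho a <= rho b.

Local Notation W := (psum psi).
Local Notation A := (laplace K rho psi).
Local Notation jt := (jtil K psi).
Local Notation tau := (tautil K rho psi).

Lemma psum0 : W 0 = 0.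
Proof. by rewrite /psum big_geq. Qed.

Lemma psumS k : W k.+1 = W k + psi k.+1 ^ 2.
Proof. by rewrite /psum big_nat_recr. Qed.

Lemma psum_ge0 k : 0 <= W k.
Proof.
elim: k => [|k IH]; first by rewrite psum0; lra.
rewrite psumS; have := pow2_ge_0 (psi k.+1); lra.
Qed.

Lemma psum_le a b : (a <= b)%N -> W a <= W b.
Proof.
move=> /subnK <-; elim: (b - a)%N => [|k IH]; first by rewrite add0n; lra.
rewrite addSn psumS; have := pow2_ge_0 (psi (k + a).+1); lra.
Qed.

Lemma sum_nat_ge0 m n (F : nat -> R) :
  (forall k, (m <= k < n)%N -> 0 <= F k) -> 0 <= \big[Rplus/0]_(m <= k < n) F k.
Proof.
move=> F0; rewrite big_nat_cond; elim/big_ind: _ => //; [lra | move=> *; lra |].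
by move=> k /andP[kmn _]; exact: F0.
Qed.

Lemma sum_nat_le m n (F G : nat -> R) :
  (forall k, (m <= k < n)%N -> F k <= G k) ->
  \big[Rplus/0]_(m <= k < n) F k <= \big[Rplus/0]_(m <= k < n) G k.
Proof.
move=> FG; rewrite big_nat_cond [X in _ <= X]big_nat_cond.
elim/big_ind2: _ => //; [lra | move=> *; lra |].
by move=> k /andP[kmn _]; exact: FG.
Qed.

Lemma sum_nat_cat m n q (F : nat -> R) : (m <= n)%N -> (n <= q)%N ->
  \big[Rplus/0]_(m <= k < q) F k =
  \big[Rplus/0]_(m <= k < n) F k + \big[Rplus/0]_(n <= k < q) F k.
Proof. by move=> mn nq; rewrite (big_cat_nat mn nq). Qed.

(** The premise says that the search in [jtil] succeeded; a failed search returns [K.+1]. *)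
Lemma psum_jtil c : (jt c <= K)%N -> c < W (jt c).
Proof.
rewrite /jtil; set P := fun j : nat => _; set s := iota 1 K => lt.
have has : has P s by rewrite has_find size_iota.
have := nth_find 0%N has; rewrite nth_iota // add1n /P.
by case: Rlt_dec.
Qed.

(** Valid for a failed search too: then every index up to [K] violates the threshold. Index 0 lies
    outside the searched list and needs [0 <= c]. *)
Lemma psum_before_jtil c k : 0 <= c -> (k < jt c)%N -> W k <= c.
Proof.
move=> c0; case: k => [|k] kj; first by rewrite psum0.
move: kj; rewrite /jtil; set P := fun j : nat => _; set s := iota 1 K.
rewrite ltnS => kf; have := before_find 0%N kf.
have := find_size P s; rewrite size_iota => fK.
rewrite nth_iota ?add1n /P; last exact: leq_trans fK.
by case: Rlt_dec => // le _; exact: Rnot_lt_le.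
Qed.

Lemma jtil_le c : 0 < c -> c < W K -> (jt c <= K)%N.
Proof.
move=> c0 cW; rewrite leqNgt; apply/negP => Kj.
by have := psum_before_jtil (Rlt_le _ _ c0) Kj; lra.
Qed.

Lemma jtil_mono c c' : 0 <= c' -> c' <= c -> (jt c <= K)%N -> (jt c' <= jt c)%N.
Proof.
move=> c0 cc jK; rewrite leqNgt; apply/negP => jj.
by have := psum_before_jtil c0 jj; have := psum_jtil jK; lra.
Qed.

Lemma rho_jtil_gt0 c : (jt c <= K)%N -> 0 < rho (jt c).
Proof. by move=> jK; apply: rho_gt0; rewrite jK. Qed.

Lemma tautil_ge c j : (jt c <= j <= K)%N -> ln (1 + W j) / (2 * rho j) <= tau c.
Proof.
rewrite -(ltnS j) => jin; have {jin} : j \in index_iota (jt c) K.+1.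
  by rewrite mem_index_iota.
rewrite /tautil.
elim: (index_iota _ _) => // a s IH; rewrite inE big_cons => /orP[/eqP <-|/IH].
  exact: Rmax_l.
move=> le; apply: Rle_trans le _; exact: Rmax_r.
Qed.

(** Positivity excludes the default value 0 of the maximum. *)
Lemma tautil_attained c : 0 < tau c ->
  exists2 j, (jt c <= j <= K)%N & tau c = ln (1 + W j) / (2 * rho j).
Proof.
move=> tau0.
suff [j jin E] : exists2 j, j \in index_iota (jt c) K.+1 &
    tau c = ln (1 + W j) / (2 * rho j).
  by exists j => //; rewrite mem_index_iota in jin.
move: tau0; rewrite /tautil; elim: (index_iota _ _) => [|a s IH].
  by rewrite big_nil; lra.
rewrite big_cons /Rmax; case: Rle_dec => _ lt; last by exists a; rewrite ?mem_head.
by have [j js E] := IH lt; exists j; rewrite // inE js orbT.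
Qed.

(** From the term [j = jt c] of the maximum. It gives [tau c > 0], and later bounds [1 / rho (jt c)]
    by a multiple of the window width. *)
Lemma tautil_rho_ge c : 0 < c -> (jt c <= K)%N -> ln (1 + c) / 2 <= tau c * rho (jt c).
Proof.
move=> c0 jK; have r0 := rho_jtil_gt0 jK.
have h : (jt c <= jt c <= K)%N by rewrite leqnn.
have := tautil_ge h.
have lnW : ln (1 + c) <= ln (1 + W (jt c)).
  by apply: Rcomplements.ln_le => //; have := psum_jtil jK; lra.
move=> /(Rmult_le_compat_r (rho (jt c)) _ _ (Rlt_le _ _ r0)).
rewrite (_ : ln (1 + W (jt c)) / _ * _ = ln (1 + W (jt c)) / 2); last by field; lra.
lra.
Qed.

Lemma tautil_gt0 c : 0 < c -> (jt c <= K)%N -> 0 < tau c.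
Proof.
move=> c0 jK; have := tautil_rho_ge c0 jK; have := rho_jtil_gt0 jK.
have : 0 < ln (1 + c) by rewrite -ln_1; apply: ln_increasing; lra.
nra.
Qed.

(** Keep the first [j] terms and replace each rate by the largest of them, [rho j]. *)
Lemma laplace_ge_partial j t : 0 <= t -> (1 <= j <= K)%N -> W j * exp (- (2 * rho j * t)) <= A t.
Proof.
move=> t0 /andP[j1 jK]; rewrite /psum big_distrl /= /laplace.
rewrite [X in _ <= X](sum_nat_cat (n := j.+1)) //.
set S1 := \big[_/_]_(_ <= _ < _) _; set S2 := \big[_/_]_(1 <= _ < _) _.
have : S1 <= S2.
  apply: sum_nat_le => k /andP[k1 kj].
  apply: Rmult_le_compat_l; first exact: pow2_ge_0.
  apply: exp_le.
  have : rho k <= rho j by apply: rho_mono => //; rewrite -ltnS kj.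
  nra.
have : 0 <= \big[Rplus/0]_(j.+1 <= i < K.+1) (psi i ^ 2 * exp (- (2 * rho i * t))).
  apply: sum_nat_ge0 => k _; apply: Rmult_le_pos; [exact: pow2_ge_0 | exact/Rlt_le/exp_pos].
lra.
Qed.

Lemma laplace_lower c t : 0 < c -> (jt c <= K)%N -> 0 <= t <= tau c ->
  c / (1 + c) * exp (2 * rho (jt c) * (tau c - t)) <= A t.
Proof.
move=> c0 jK [t0 tt]; have tau0 := tautil_gt0 c0 jK.
have [j /andP[jj jK'] E] := tautil_attained tau0.
have rj : rho (jt c) <= rho j by apply: rho_mono => //; rewrite jj.
have r0 := rho_jtil_gt0 jK.
apply: Rle_trans (laplace_ge_partial t0 (j := j) _); last by rewrite jK' (leq_trans _ jj).
have cW : c < W j by apply: Rlt_le_trans (psum_jtil jK) (psum_le jj).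
(* The maximizing [j] satisfies this equality, which trades the partial sum for an exponential in
   [tau c]. *)
have EW : 1 + W j = exp (2 * rho j * tau c).
  rewrite E -[LHS]exp_ln; last lra.
  by congr exp; field; lra.
have : exp (2 * rho (jt c) * (tau c - t)) <= exp (2 * rho j * (tau c - t)).
  by apply: exp_le; nra.
have -> : exp (2 * rho j * (tau c - t)) = (1 + W j) * exp (- (2 * rho j * t)).
  by rewrite EW -exp_plus; congr exp; ring.
move=> le.
have f0 : 0 <= c / (1 + c) by apply: Rlt_le; apply: Rdiv_lt_0_compat; lra.
(* The factor [c / (1 + c)] turns [1 + W j] back into at most [W j], because [W j > c]. *)
apply: Rle_trans (Rmult_le_compat_l _ _ _ f0 le) _.
rewrite -Rmult_assoc; apply: Rmult_le_compat_r; first exact/Rlt_le/exp_pos.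
apply: (Rmult_le_reg_r (1 + c)); first lra.
rewrite (_ : c / (1 + c) * (1 + W j) * (1 + c) = c * (1 + W j)); last by field; lra.
nra.
Qed.

(* Comparison of the sum of [w (1 + W) ^ - (1 + s)] with the integral of [x ^ - (1 + s)]. *)
Lemma power_telescope (y z s : R) : 0 < y -> y <= z -> 0 < s ->
  s * (z - y) * exp (- (1 + s) * ln z) <= exp (- s * ln y) - exp (- s * ln z).
Proof.
move=> y0 yz s0; have z0 : 0 < z by lra.
have lnq : ln y - ln z <= y / z - 1.
  rewrite -Rcomplements.ln_div //; have q0 : 0 < y / z by apply: Rdiv_lt_0_compat.
  by have := exp_ineq1_le (ln (y / z)); rewrite exp_ln //; lra.
have -> : exp (- s * ln y) = exp (- s * ln z) * exp (- s * (ln y - ln z)).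
  by rewrite -exp_plus; congr exp; ring.
have -> : exp (- (1 + s) * ln z) = exp (- s * ln z) / z.
  rewrite (_ : - (1 + s) * ln z = - s * ln z + - ln z); last by ring.
  by rewrite exp_plus exp_Ropp exp_ln.
have := exp_ineq1_le (- s * (ln y - ln z)) => h.
have := exp_pos (- s * ln z); set E := exp (- s * ln z) => E0.
have -> : s * (z - y) * (E / z) = E * (s * (1 - y / z)) by field; lra.
rewrite -[X in _ <= _ - X]Rmult_1_r -Rmult_minus_distr_l.
apply: Rmult_le_compat_l; first lra.
have := Rmult_le_compat_l s _ _ (Rlt_le _ _ s0) lnq; lra.
Qed.

(** Since [psi k ^ 2] is the increment of [W], [power_telescope] makes the sum telescope. What
    remains is at most [(1 + W a) ^ - s <= 1], whatever the upper end [b]. *)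
Lemma sum_power_bound a b s : 0 < s -> (a <= b)%N ->
  \big[Rplus/0]_(a.+1 <= k < b.+1) (psi k ^ 2 * exp (- (1 + s) * ln (1 + W k))) <= 1 / s.
Proof.
move=> s0 ab.
have H : s * \big[Rplus/0]_(a.+1 <= k < b.+1) (psi k ^ 2 * exp (- (1 + s) * ln (1 + W k)))
    <= exp (- s * ln (1 + W a)) - exp (- s * ln (1 + W b)).
  elim: b ab => [|b IH]; first by rewrite leqn0 => /eqP ->; rewrite big_geq //; lra.
  rewrite leq_eqVlt => /orP[/eqP ->|]; first by rewrite big_geq //; lra.
  rewrite ltnS => ab; rewrite big_nat_recr //=.
  have := IH ab; have := psumS b.
  have := @power_telescope (1 + W b) (1 + W b.+1) s.
  have := psum_ge0 b; have := @psum_le b b.+1 (leqnSn b).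
  set S := \big[_/_]_(_ <= _ < _) _.
  move=> h1 h2 /(_ ltac:(lra) ltac:(lra) s0) h3 h4 h5.
  move: h3; rewrite (_ : 1 + W b.+1 - (1 + W b) = psi b.+1 ^ 2); last by rewrite psumS; ring.
  simpl; simpl in h5; lra.
have le1 : exp (- s * ln (1 + W a)) <= 1.
  rewrite -[X in _ <= X]exp_0; apply: exp_le.
  have : 0 <= ln (1 + W a); last by move=> h; have := Rmult_le_pos _ _ (Rlt_le _ _ s0) h; lra.
  by rewrite -ln_1; apply: Rcomplements.ln_le; have := psum_ge0 a; lra.
apply: (Rmult_le_reg_l s) => //.
have := exp_pos (- s * ln (1 + W b)).
rewrite (_ : s * (1 / s) = 1); last by field; lra.
lra.
Qed.

Lemma laplace_upper c c' u : 0 < c' -> c' <= c -> (jt c <= K)%N -> 0 < u ->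
  A (tau c + u) <= c' + c * exp (- (2 * rho (jt c') * tau c))
                   + 2 * tau c / u * exp (- (rho (jt c) * u)).
Proof.
move=> c'0 cc jK u0; have c0 : 0 < c by lra.
have jj := jtil_mono (Rlt_le _ _ c'0) cc jK.
have tau0 := tautil_gt0 c0 jK; have r0 := rho_jtil_gt0 jK.
have r'0 := rho_jtil_gt0 (leq_trans jj jK).
set t := tau c + u.
rewrite /laplace (sum_nat_cat (n := jt c)) //; last exact: leq_trans jK _.
rewrite (sum_nat_cat (n := jt c')) //.
(* Below [jt c'] the total mass is at most [c'], and the exponentials are at most 1. *)
have first_block : \big[Rplus/0]_(1 <= k < jt c') (psi k ^ 2 * exp (- (2 * rho k * t))) <= c'.
  apply: (Rle_trans _ (W (jt c').-1)); last first.
    by apply: psum_before_jtil; [lra | ].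
  rewrite /psum; apply: sum_nat_le => k /andP[k1 kj].
  rewrite -[X in _ <= X]Rmult_1_r; apply: Rmult_le_compat_l; first exact: pow2_ge_0.
  rewrite -[X in _ <= X]exp_0; apply: exp_le.
  have : 0 < rho k by apply: rho_gt0; rewrite k1 (leq_trans (ltnW kj)) // (leq_trans jj).
  rewrite /t; nra.
(* Here the mass is at most [c] and every rate is at least [rho (jt c')]. *)
have second_block : \big[Rplus/0]_(jt c' <= k < jt c) (psi k ^ 2 * exp (- (2 * rho k * t)))
    <= c * exp (- (2 * rho (jt c') * tau c)).
  apply: (Rle_trans _ (W (jt c).-1 * exp (- (2 * rho (jt c') * tau c)))); last first.
    apply: Rmult_le_compat_r; first exact/Rlt_le/exp_pos.
    by apply: psum_before_jtil; [lra | ].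
  rewrite /psum big_distrl /= [X in _ <= X](sum_nat_cat (n := jt c')) //.
  rewrite -[X in X <= _]Rplus_0_l; apply: Rplus_le_compat.
    apply: sum_nat_ge0 => k _; apply: Rmult_le_pos; [exact: pow2_ge_0 | exact/Rlt_le/exp_pos].
  apply: sum_nat_le => k /andP[k1 kj].
  apply: Rmult_le_compat_l; first exact: pow2_ge_0.
  apply: exp_le.
  have : rho (jt c') <= rho k.
    by apply: rho_mono => //; rewrite k1 (leq_trans (ltnW kj)).
  rewrite /t; nra.
have third_block : \big[Rplus/0]_(jt c <= k < K.+1) (psi k ^ 2 * exp (- (2 * rho k * t)))
    <= 2 * tau c / u * exp (- (rho (jt c) * u)).
  (* Half of the extra decay [2 rho_k u] raises the power of [1 + W k] from 1 to [1 + s], as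
     [2 rho_k tau s = rho_k u]; the other half leaves [exp (- rho_k u)]. Then [1 / s] is the
     prefactor claimed. *)
  pose s := u / (2 * tau c).
  have s0 : 0 < s by apply: Rdiv_lt_0_compat; lra.
  apply: (Rle_trans _ (\big[Rplus/0]_((jt c).-1.+1 <= k < K.+1)
      (psi k ^ 2 * exp (- (1 + s) * ln (1 + W k)) * exp (- (rho (jt c) * u))))).
    apply: sum_nat_le => k /andP[k1 kK].
    rewrite [X in _ <= X]Rmult_assoc -exp_plus; apply: Rmult_le_compat_l; first exact: pow2_ge_0.
    apply: exp_le.
    have rk : rho (jt c) <= rho k by apply: rho_mono => //; rewrite k1.
    have jkK : (jt c <= k <= K)%N by rewrite k1.
    have lnle : ln (1 + W k) <= 2 * rho k * tau c.
      have := tautil_ge jkK.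
      move=> /(Rmult_le_compat_r (2 * rho k) _ _ ltac:(lra)).
      rewrite (_ : ln (1 + W k) / _ * _ = ln (1 + W k)); last by field; lra.
      lra.
    have st : s * (2 * tau c) = u by rewrite /s; field; lra.
    have : (1 + s) * ln (1 + W k) <= (1 + s) * (2 * rho k * tau c).
      by apply: Rmult_le_compat_l; lra.
    rewrite (_ : (1 + s) * (2 * rho k * tau c) = 2 * rho k * tau c + rho k * (s * (2 * tau c)));
      last by ring.
    rewrite st /t; nra.
  rewrite -big_distrl /=; apply: Rmult_le_compat_r; first exact/Rlt_le/exp_pos.
  apply: Rle_trans (sum_power_bound s0 _) _ => /=; first exact: leq_trans (leq_pred _) jK.
  by right; rewrite /s; field; lra.
lra.
Qed.

Lemma laplace_at0 : A 0 = W K.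
Proof.
rewrite /laplace /psum; apply: eq_bigr => k _.
by rewrite Rmult_0_r Ropp_0 exp_0 Rmult_1_r.
Qed.

Lemma laplace_le s t : s <= t -> A t <= A s.
Proof.
move=> st; apply: sum_nat_le => k kK; apply: Rmult_le_compat_l; first exact: pow2_ge_0.
by apply: exp_le; have := rho_gt0 kK; nra.
Qed.

End Laplace.

(** * Cutoff *)

Definition eventually (P : nat -> Prop) : Prop :=
  exists n0, forall n, (n0 <= n)%N -> P n.

Lemma eventually_and P Q :
  eventually P -> eventually Q -> eventually (fun n => P n /\ Q n).
Proof.
move=> [a Pa] [b Qb]; exists (maxn a b) => n.
by rewrite geq_max => /andP[/Pa ? /Qb ?].
Qed.

Lemma eventually_mono (P Q : nat -> Prop) :
  (forall n, P n -> Q n) -> eventually P -> eventually Q.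
Proof. by move=> PQ [a Pa]; exists a => n /Pa/PQ. Qed.

Lemma cv_inftyE (u : nat -> R) :
  cv_infty u <-> forall M, eventually (fun n => M < u n).
Proof.
by split=> H M; have [n0 Hn] := H M; exists n0 => n /leP; apply: Hn.
Qed.

Lemma Un_cv0E (u : nat -> R) : (forall n, 0 <= u n) ->
  Un_cv u 0 <-> forall eps, 0 < eps -> eventually (fun n => u n < eps).
Proof.
move=> u0; split=> H eps eps0; have [n0 Hn] := H eps eps0; exists n0 => n /leP nn.
  by have := Hn n nn; rewrite /Rdist Rminus_0_r Rabs_pos_eq.
by rewrite /Rdist Rminus_0_r Rabs_pos_eq //; apply: Hn.
Qed.

Lemma exp_decay C k delta : 0 < C -> 0 < k -> 0 < delta ->
  exists M, forall x, M < x -> C * exp (- (k * x)) < delta.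
Proof.
move=> C0 k0 d0; exists (ln (C / delta) / k) => x xM.
have Cd : 0 < C / delta by apply: Rdiv_lt_0_compat.
have : exp (- (k * x)) < exp (- ln (C / delta)).
  apply: exp_increasing.
  have := Rmult_lt_compat_l k _ _ k0 xM.
  rewrite (_ : k * (ln (C / delta) / k) = ln (C / delta)); last by field; lra.
  lra.
rewrite [X in _ < X]exp_Ropp exp_ln // => lt.
have -> : delta = C * / (C / delta) by field; lra.
exact: Rmult_lt_compat_l.
Qed.

Section Cutoff.
Variables (K : nat -> nat) (rho psi : nat -> nat -> R) (d : nat -> R -> R).
Hypothesis rho_gt0 : forall n k, (1 <= k <= K n)%N -> 0 < rho n k.
Hypothesis rho_mono : forall n a b, (1 <= a)%N -> (a <= b <= K n)%N -> rho n a <= rho n b.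
Hypothesis d_ge0 : forall n t, 0 <= d n t.
Hypothesis d_cont : forall n, continuity (fun t => d n t ^ 2).

Local Notation A n := (laplace (K n) (rho n) (psi n)).
Local Notation jt n c := (jtil (K n) (psi n) c).
Local Notation tau n c := (tautil (K n) (rho n) (psi n) c).
Local Notation r n c := (rho n (jt n c)).

Hypothesis d_laplace : forall n t, A n t <= d n t ^ 2 <= exp (A n t) - 1.

Lemma dist_infty (s : nat -> R) :
  cv_infty (fun n => d n (s n)) <-> forall M, eventually (fun n => M < A n (s n)).
Proof.
rewrite cv_inftyE; split=> H M.
  (* With [m = Rmax M 0], [exp m >= 1]; so [d > exp m] passes to [d ^ 2], which is below [exp A]. *)
  apply: eventually_mono (H (exp (Rmax M 0))) => n lt.
  have := Rmax_l M 0; have := Rmax_r M 0; set m := Rmax M 0 in lt * => m0 Mm.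
  have e1 : 1 <= exp m by rewrite -[X in X <= _]exp_0; apply: exp_le.
  have : exp m < exp (A n (s n)) by have := d_laplace n (s n); nra.
  by move/exp_lt_inv; lra.
apply: eventually_mono (H (M ^ 2)) => n lt.
have := d_laplace n (s n); have := d_ge0 n (s n) => d0 h.
apply: Rnot_le_lt => le; nra.
Qed.

Lemma dist_zero (s : nat -> R) :
  Un_cv (fun n => d n (s n)) 0 <->
  forall eps, 0 < eps -> eventually (fun n => A n (s n) < eps).
Proof.
rewrite Un_cv0E; last by move=> n; exact: d_ge0.
split=> H eps eps0.
  have m0 : 0 < Rmin 1 eps by apply: Rmin_pos; lra.
  apply: eventually_mono (H _ m0) => n lt.
  have := Rmin_l 1 eps; have := Rmin_r 1 eps.
  have := d_laplace n (s n); have := d_ge0 n (s n); nra.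
(* The level of [A] at which [exp A - 1] equals [eps ^ 2]. *)
have e0 : 0 < ln (1 + eps ^ 2) by rewrite -ln_1; apply: ln_increasing; nra.
apply: eventually_mono (H _ e0) => n /exp_increasing; rewrite exp_ln; last nra.
have := d_laplace n (s n); have := d_ge0 n (s n) => d0 h1 h2.
apply: Rnot_le_lt => le; nra.
Qed.

(** The clause on [jt n c] says that the threshold [c] is eventually reached, so that the quantities
    compared are the genuine ones. *)
Definition spectral_condition : Prop :=
  forall c : R, 0 < c -> forall M : R, exists n0, forall n, (n0 <= n)%N ->
    (jt n c <= K n)%N /\ M < tau n c * r n c.

(** [laplace_upper] with [c' = c] and [u = tau n c]: the three terms are at most [c], [c] and 2. *)
Lemma laplace_double n c : 0 < c -> (jt n c <= K n)%N ->
  A n (2 * tau n c) <= 2 * c + 2.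
Proof.
move=> c0 jK.
have tau0 := tautil_gt0 (@rho_gt0 n) c0 jK.
have r0 := rho_jtil_gt0 (@rho_gt0 n) jK.
have := laplace_upper (@rho_gt0 n) (@rho_mono n) c0 (Rle_refl c) jK tau0.
rewrite (_ : tau n c + tau n c = 2 * tau n c); last by ring.
rewrite (_ : 2 * tau n c / tau n c = 2); last by field; lra.
have e1 : exp (- (2 * r n c * tau n c)) <= 1.
  by rewrite -[X in _ <= X]exp_0; apply: exp_le; nra.
have e2 : exp (- (r n c * tau n c)) <= 1.
  by rewrite -[X in _ <= X]exp_0; apply: exp_le; nra.
nra.
Qed.

(** Only [a = 1 / 2] is used. Large [A] at [t / 2] forces [tau >= t / 4], small [A] at [3 t / 2]
    forces [r t > 4 M]; multiply. *)
Lemma cutoff_spectral_condition : has_cutoff d -> spectral_condition.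
Proof.
move=> [t [t0 [_ cut]]] c c0 M.
have [|lim0 liminf] := cut (1 / 2); first lra.
(* [2 c + 2] is the bound of [laplace_double] and also exceeds [c]. In the next line [12 M] is three
   times [4 M], because the exponent at [3 t / 2] is [3 r t]. *)
have H1 := proj1 (dist_infty _) liminf (2 * c + 2).
have H2 := proj1 (dist_zero _) lim0 (c * exp (- (12 * M))).
have {H2} := eventually_and H1 (H2 (Rmult_lt_0_compat _ _ c0 (exp_pos _))).
apply: eventually_mono => n [h1 h2].
have tn := t0 n.
have jK : (jt n c <= K n)%N.
  apply: jtil_le => //; rewrite -(laplace_at0 _ (rho n)).
  have := @laplace_le _ _ (psi n) (@rho_gt0 n) 0 ((1 - 1 / 2) * t n); lra.
split=> //.
have r0 := rho_jtil_gt0 (@rho_gt0 n) jK.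
have tau_t : t n / 4 <= tau n c.
  apply: Rnot_lt_le => lt.
  have := laplace_double c0 jK.
  have := @laplace_le _ _ (psi n) (@rho_gt0 n) (2 * tau n c) ((1 - 1 / 2) * t n); lra.
have rt : 4 * M < r n c * t n.
  have jj : (1 <= jt n c <= K n)%N by rewrite jK.
  have s0 : 0 <= (1 + 1 / 2) * t n by lra.
  have := laplace_ge_partial (psi n) (@rho_mono n) s0 jj.
  have := psum_jtil jK.
  have := exp_pos (- (2 * r n c * ((1 + 1 / 2) * t n))) => e0 Wc le.
  have : exp (- (2 * r n c * ((1 + 1 / 2) * t n))) < exp (- (12 * M)) by nra.
  by move/exp_lt_inv; lra.
nra.
Qed.

(* [A (2 tau(c))] is bounded while [A] blows up to the left of [tau(c')], hence
[tau(c') - 2 tau(c) = O(1 / rho_{j(c')})]. *)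
Lemma mixed_spectral_condition c c' : spectral_condition -> 0 < c' -> c' <= c ->
  forall M, eventually (fun n => M < r n c' * tau n c).
Proof.
move=> cond c'0 cc M; have c0 : 0 < c by lra.
(* The bound on [A] at [2 tau(c)] divided by the constant [c' / (1 + c')] of the lower bound. *)
pose B := (2 * c + 2) * (1 + c') / c'.
have B0 : 0 < B by rewrite /B; apply: Rdiv_lt_0_compat => //; nra.
apply: eventually_mono (eventually_and (cond c c0 0) (cond c' c'0 (2 * M + B))).
move=> n [[jK _] [jK' lt]].
have tau0 := tautil_gt0 (@rho_gt0 n) c0 jK.
have r'0 := rho_jtil_gt0 (@rho_gt0 n) jK'.
(* If [tau(c') < 2 tau(c)], the condition at [c'] suffices. Otherwise [r' (tau(c') - 2 tau(c)) < B],
   which the margin [B] in [2 M + B] absorbs. *)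
have [le|gt] := Rle_lt_dec (2 * tau n c) (tau n c'); last by nra.
have h : 0 <= 2 * tau n c <= tau n c' by lra.
have := laplace_lower (@rho_gt0 n) (@rho_mono n) c'0 jK' h.
have := laplace_double c0 jK.
have := exp_ineq1_le (2 * r n c' * (tau n c' - 2 * tau n c)).
set E := exp _ => e1 e2 e3.
have : E <= B.
  rewrite /B; apply: (Rmult_le_reg_r (c' / (1 + c'))).
    by apply: Rdiv_lt_0_compat; lra.
  rewrite (_ : _ * (1 + c') / c' * (c' / (1 + c')) = 2 * c + 2); last by field; lra.
  lra.
nra.
Qed.

(** The upper bound with [u = a tau] handles the right side, the lower bound at [(1 - a) tau] the
    left. *)
Lemma spectral_cutoff_time c : spectral_condition -> 0 < c ->
  cutoff_time d (fun n => tau n c).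
Proof.
move=> cond c0; split.
  by apply: eventually_mono (cond c c0 0) => n [jK _]; exact: (tautil_gt0 (@rho_gt0 n) c0 jK).
move=> a a01; split.
  apply/dist_zero => delta delta0.
  (* Each of the three terms of [laplace_upper] receives [delta / 3]; the middle one needs the mixed
     condition, since it pairs the rate at [c'] with [tau] at [c]. *)
  pose c' := Rmin c (delta / 3).
  have c'0 : 0 < c' by apply: Rmin_pos; lra.
  have cc : c' <= c := Rmin_l _ _.
  have cd : c' <= delta / 3 := Rmin_r _ _.
  have d3 : 0 < delta / 3 by lra.
  have [M1 HM1] := @exp_decay c 2 (delta / 3) c0 ltac:(lra) d3.
  have a2 : 0 < 2 / a by apply: Rdiv_lt_0_compat; lra.
  have [M2 HM2] := @exp_decay (2 / a) a (delta / 3) a2 ltac:(lra) d3.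
  apply: eventually_mono (eventually_and (mixed_spectral_condition cond c'0 cc M1)
     (cond c c0 M2)) => n [h1 [jK h2]].
  have tau0 := tautil_gt0 (@rho_gt0 n) c0 jK.
  have u0 : 0 < a * tau n c by nra.
  have := laplace_upper (@rho_gt0 n) (@rho_mono n) c'0 cc jK u0.
  rewrite (_ : (1 + a) * tau n c = tau n c + a * tau n c); last by ring.
  rewrite (_ : 2 * tau n c / (a * tau n c) = 2 / a); last by field; lra.
  have := HM1 _ h1; have := HM2 _ h2.
  rewrite (_ : a * (tau n c * r n c) = r n c * (a * tau n c)); last by ring.
  rewrite (_ : 2 * (r n c' * tau n c) = 2 * r n c' * tau n c); last by ring.
  lra.
apply/dist_infty => M.
(* By [exp x >= 1 + x] the lower bound exceeds [k tau r]. *)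
pose k := c / (1 + c) * (2 * a).
have f0 : 0 < c / (1 + c) by apply: Rdiv_lt_0_compat; lra.
have k0 : 0 < k by rewrite /k; nra.
apply: eventually_mono (cond c c0 (M / k)) => n [jK lt].
have tau0 := tautil_gt0 (@rho_gt0 n) c0 jK.
have h : 0 <= (1 - a) * tau n c <= tau n c by nra.
have := laplace_lower (@rho_gt0 n) (@rho_mono n) c0 jK h.
have := exp_ineq1_le (2 * r n c * (tau n c - (1 - a) * tau n c)).
set E := exp _ => e1 e2.
have : M < k * (tau n c * r n c).
  have := Rmult_lt_compat_l k _ _ k0 lt.
  by rewrite (_ : k * (M / k) = M) //; field; lra.
have : c / (1 + c) * (2 * r n c * (tau n c - (1 - a) * tau n c)) < c / (1 + c) * E.
  by apply: Rmult_lt_compat_l => //; lra.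
rewrite /k; lra.
Qed.

Lemma spectral_condition_cutoff : spectral_condition -> has_cutoff d.
Proof.
move=> cond.
have [[n0 pos] cut] := spectral_cutoff_time cond Rlt_0_1.
(* [has_cutoff] asks for positivity at every [n], but [tau n 1] may be 0 for finitely many [n]; 1 is
   a filler. *)
pose t n := if Rlt_dec 0 (tau n 1) then tau n 1 else 1.
have tE n : (n0 <= n)%N -> t n = tau n 1.
  by move=> /pos; rewrite /t; case: Rlt_dec.
have t0 n : 0 < t n by rewrite /t; case: Rlt_dec => /= *; lra.
exists t; split=> //; split; first by exists 0%N.
move=> a /cut[c1 c2]; split.
  move=> eps /c1[n1 H]; exists (maxn n0 n1) => n /leP; rewrite geq_max => /andP[n0n /leP n1n].
  by rewrite tE //; apply: H.
move=> M; have [n1 H] := c2 M; exists (maxn n0 n1) => n /leP.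
by rewrite geq_max => /andP[n0n /leP n1n]; rewrite tE //; apply: H.
Qed.

(** Let [x = sqrt (tau / r)]. Above, [d <= eps] at [tau + M x]. Below, the exponential lower bound
    gives [tau - T <= B / r], and [1 / r = O(x)] since [tau r] is bounded away from 0. *)
Lemma spectral_window c eps : spectral_condition -> 0 < c -> 0 < eps ->
  exists (n0 : nat) (C : R), forall n, (n0 <= n)%N ->
    Rabs (Tmix (d n) eps - tau n c) <= C * sqrt (tau n c / r n c).
Proof.
move=> cond c0 eps0.
pose eta := ln (1 + eps ^ 2).
have eta0 : 0 < eta by rewrite /eta -ln_1; apply: ln_increasing; nra.
(* Three terms of at most [eta / 4] each stay below [eta], that is, [exp A - 1 < eps ^ 2]. *)
pose c' := Rmin c (eta / 4).
have c'0 : 0 < c' by apply: Rmin_pos; lra.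
have cc : c' <= c := Rmin_l _ _.
have ce : c' <= eta / 4 := Rmin_r _ _.
(* Chosen so that [2 / M ^ 2 = eta / 4], the value left by the third term. *)
pose M := sqrt (8 / eta).
have M0 : 0 < M by apply: sqrt_lt_R0; apply: Rdiv_lt_0_compat; lra.
have MM : M * M = 8 / eta by rewrite sqrt_sqrt //; apply: Rlt_le; apply: Rdiv_lt_0_compat; lra.
(* Inverse of the lower bound for [tau r] in [tautil_rho_ge]; hence [1 / r ^ 2 <= k tau / r]. *)
pose k := 2 / ln (1 + c).
have ln0 : 0 < ln (1 + c) by rewrite -ln_1; apply: ln_increasing; lra.
have k0 : 0 < k by apply: Rdiv_lt_0_compat; lra.
(* From [c / (1 + c) exp (2 r (tau - T)) <= eps ^ 2] and [exp y >= 1 + y]. *)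
pose B := eps ^ 2 * (1 + c) / (2 * c).
have B0 : 0 < B by apply: Rdiv_lt_0_compat; [apply: Rmult_lt_0_compat; [exact: pow_lt | lra] | lra].
have e4 : 0 < eta / 4 by lra.
have [M1 HM1] := @exp_decay c 2 (eta / 4) c0 ltac:(lra) e4.
have [n0 Hn] := eventually_and (mixed_spectral_condition cond c'0 cc M1) (cond c c0 0).
exists n0, (M + B * sqrt k) => n /Hn[h1 [jK _]].
have tau0 := tautil_gt0 (@rho_gt0 n) c0 jK.
have r0 := rho_jtil_gt0 (@rho_gt0 n) jK.
set x := sqrt (tau n c / r n c).
have tr0 : 0 < tau n c / r n c by apply: Rdiv_lt_0_compat.
have x0 : 0 < x by apply: sqrt_lt_R0.
have xx : x * x = tau n c / r n c by apply: sqrt_sqrt; lra.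
have u0 : 0 < M * x by nra.
have small : A n (tau n c + M * x) < eta.
  have := laplace_upper (@rho_gt0 n) (@rho_mono n) c'0 cc jK u0.
  have := HM1 _ h1.
  rewrite (_ : 2 * (r n c' * tau n c) = 2 * r n c' * tau n c); last by ring.
  (* [y exp (- y) <= 1] at [y = r u], with [u ^ 2 = M ^ 2 tau / r] *)
  have : 2 * tau n c / (M * x) * exp (- (r n c * (M * x))) <= eta / 4; last by lra.
  have ru0 : 0 < r n c * (M * x) by nra.
  have le : exp (- (r n c * (M * x))) <= / (r n c * (M * x)).
    rewrite exp_Ropp; apply: Rinv_le_contravar => //.
    by have := exp_ineq1_le (r n c * (M * x)); lra.
  apply: Rle_trans (Rmult_le_compat_l _ _ _ _ le) _.
    by apply: Rlt_le; apply: Rdiv_lt_0_compat; lra.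
  right; rewrite (_ : _ * _ = 2 * (tau n c / r n c) / ((M * M) * (x * x))); last by field; lra.
  by rewrite xx MM; field; lra.
have dle : d n (tau n c + M * x) <= eps.
  have := d_laplace n (tau n c + M * x); have := d_ge0 n (tau n c + M * x).
  move: small => /exp_increasing; rewrite exp_ln; last nra.
  move=> h2 d0 h3; apply: Rnot_lt_le => lt; nra.
have tu0 : 0 <= tau n c + M * x by lra.
have [T0 [dT Tmin]] := Tmix_spec (@d_cont n) (d_ge0 n) tu0 dle.
have Tup := Tmin _ tu0 dle.
set T := Tmix _ _ in T0 dT Tup *.
have inv_r : / r n c <= sqrt k * x.
  rewrite -[X in X <= _]sqrt_Rsqr; last by apply/Rlt_le/Rinv_0_lt_compat.
  rewrite /x -sqrt_mult; try lra.
  apply: sqrt_le_1_alt; rewrite /Rsqr.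
  have := tautil_rho_ge (@rho_gt0 n) c0 jK => h2.
  have : 1 <= k * (tau n c * r n c).
    have := Rmult_le_compat_l k _ _ (Rlt_le _ _ k0) h2.
    by rewrite (_ : k * (ln (1 + c) / 2) = 1) //; rewrite /k; field; lra.
  move=> h3; have i0 := Rinv_0_lt_compat _ r0.
  rewrite (_ : k * (tau n c / r n c) = / r n c * / r n c * (k * (tau n c * r n c)));
    last by field; lra.
  nra.
have Tlow : tau n c - T <= B * / r n c.
  have [le|lt] := Rle_lt_dec (tau n c) T.
    by have := Rmult_lt_0_compat _ _ B0 (Rinv_0_lt_compat _ r0); lra.
  have h : 0 <= T <= tau n c by lra.
  have := laplace_lower (@rho_gt0 n) (@rho_mono n) c0 jK h.
  have := exp_ineq1_le (2 * r n c * (tau n c - T)); set E := exp _ => e1 e2.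
  have Ele : E <= eps ^ 2 * (1 + c) / c.
    apply: (Rmult_le_reg_l (c / (1 + c))); first by apply: Rdiv_lt_0_compat; lra.
    rewrite (_ : c / (1 + c) * (eps ^ 2 * (1 + c) / c) = eps ^ 2); last by field; lra.
    have := d_laplace n T; have := d_ge0 n T; nra.
  apply: (Rmult_le_reg_l (2 * r n c)); first lra.
  rewrite (_ : 2 * r n c * (B * / r n c) = eps ^ 2 * (1 + c) / c); last by rewrite /B; field; lra.
  lra.
have := Rmult_le_compat_l B _ _ (Rlt_le _ _ B0) inv_r => h2.
have sk := sqrt_pos k.
have Bkx : 0 <= B * (sqrt k * x) by apply: Rmult_le_pos; nra.
apply: Rabs_le; split; nra.
Qed.

End Cutoff.

(** * Cutoff for reversible product chains *)

Theorem theorem4p2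
  (l : nat -> nat) (N : forall n, 'I_(l n) -> nat)
  (mu pi : forall n (i : 'I_(l n)), 'I_(N n i) -> R)
  (L : forall n (i : 'I_(l n)), 'I_(N n i) -> 'I_(N n i) -> R)
  (p : forall n, 'I_(l n) -> R)
  (lam : forall n (i : 'I_(l n)), 'I_(N n i) -> R)
  (phi : forall n (i : 'I_(l n)), 'I_(N n i) -> 'I_(N n i) -> R)
  (e : forall n, nat -> idx (N n)) :
  (forall n i, finite_chain (mu n i) (L n i) (pi n i)) ->
  (forall n i, reversible (L n i) (pi n i)) ->
  (forall n i, (0 < p n i)%R) ->
  (forall n, (rsum (p n) <= 1)%R) ->
  (forall n i, eigen_data (L n i) (pi n i) (lam n i) (phi n i)) ->
  (forall n, sorted_enum (p n) (lam n) (e n)) ->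
  let d := fun n t => dprod (mu n) (pi n) (p n) (L n) t in
  let K := fun n => Kdim (N n) in
  let rho := fun n => rho_of (p n) (lam n) (e n) in
  let psi := fun n => psi_of (mu n) (phi n) (e n) in
  let jt := fun n c => jtil (K n) (psi n) c in
  let tau := fun n c => tautil (K n) (rho n) (psi n) c in
  (has_cutoff d <->
     forall c : R, (0 < c)%R -> forall M : R, exists n0, forall n, (n0 <= n)%N ->
       (jt n c <= K n)%N /\ (M < tau n c * rho n (jt n c))%R) /\
  (has_cutoff d ->
     forall c : R, (0 < c)%R ->
       cutoff_time d (fun n => tau n c) /\
       forall eps : R, (0 < eps)%R -> exists (n0 : nat) (C : R), forall n, (n0 <= n)%N ->
         (Rabs (Tmix (d n) eps - tau n c) <= C * sqrt (tau n c / rho n (jt n c)))%R).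
Proof.
move=> fc rev p0 _ ed se d K rho psi jt tau.
pose rho0 n := rho_of_gt0 (fc n) (rev n) (p0 n) (ed n) (se n).
pose lap n := dist_laplace (fc n) (rev n) (ed n) (se n).
pose cont n := dist_continuity (p n) (fc n) (rev n) (ed n).
have mono n a b : (1 <= a)%N -> (a <= b <= K n)%N -> rho n a <= rho n b.
  by case: (se n) => _ [_ [_]]; apply.
have d0 n t : 0 <= d n t by exact: sqrt_pos.
have condE : has_cutoff d <-> spectral_condition K rho psi.
  split; first exact: (cutoff_spectral_condition rho0 mono d0 lap).
  exact: (spectral_condition_cutoff rho0 mono d0 lap).
split; first exact: condE.
move=> /condE cond c c0; split.
  exact: (spectral_cutoff_time rho0 mono d0 lap cond c0).
by move=> eps eps0; exact: (spectral_window rho0 mono d0 cont lap cond c0 eps0).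
Qed.
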